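(* There is a (lightface) $\Sigma^1_1$ monotone subset of $2^\omega$ which is $\boldsymbol{\Sigma}^1_1$-complete.
   Context: A set $A\subseteq2^\omega$ is monotone if for all $x,y\in2^\omega$ with $x\in A$ and $\{n:x(n)=1\}\subseteq\{n:y(n)=1\}$ we have $y\in A$. A set $A\subseteq\mathcal{X}$ is $\boldsymbol{\Sigma}^1_1$-complete if for every zero-dimensional Polish space $\mathcal{Z}$ and every $\boldsymbol{\Sigma}^1_1$ (analytic) set $P\subseteq\mathcal{Z}$ there is a continuous function $f:\mathcal{Z}\to\mathcal{X}$ with $P=f^{-1}[A]$. *)

(* Defs.v *)
From HB Require Import structures.
From mathcomp Require Import all_boot all_order all_algebra.
From mathcomp Require Import all_classical all_reals all_analysis.

Set Implicit Arguments.
Unset Strict Implicit.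
Unset Printing Implicit Defensive.

Import Order.TTheory GRing.Theory Num.Theory.

Local Open Scope classical_set_scope.

(* omega^omega with the product of the discrete topologies, in the same style
   as the library's [cantor_space] *)
Definition baire_space : Type := prod_topology (fun _ : nat => nat).

HB.instance Definition _ := Pointed.on baire_space.
HB.instance Definition _ := Nbhs.on baire_space.
HB.instance Definition _ := Topological.on baire_space.
HB.instance Definition _ := Uniform.on baire_space.

Definition monotone_set (A : set cantor_space) : Prop :=
  forall x y : cantor_space,
    A x -> [set n | x n = true] `<=` [set n | y n = true] -> A y.

Definition polish (R : realType) (Z : topologicalType) : Prop :=
  (exists D : set Z, countable D /\ dense D) /\
  exists d : Z -> Z -> R,
    [/\ (forall x y, (0 <= d x y)%R /\ (d x y = 0%R <-> x = y)),
        (forall x y, d x y = d y x),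
        (forall x y z, (d x z <= d x y + d y z)%R),
        (forall (x : Z) (U : set Z), nbhs x U <->
           exists2 e : R, (0 < e)%R & [set y | (d x y < e)%R] `<=` U) &
        (forall u : nat -> Z,
           (forall e : R, (0 < e)%R -> exists N : nat,
              forall m n : nat, (N <= m)%N -> (N <= n)%N ->
                (d (u m) (u n) < e)%R) ->
           exists l : Z, u @ \oo --> l)].

(* The library's [zero_dimensional] only asks that distinct points be separated
   by a clopen set, which is weaker than having a base of clopen sets. *)
Definition clopen_base (Z : topologicalType) : Prop :=
  forall (x : Z) (U : set Z), nbhs x U ->
    exists V : set Z, [/\ clopen V, V x & V `<=` U].

(* boldface Sigma^1_1: projections along omega^omega of closed sets *)
Definition analytic (Z : topologicalType) (P : set Z) : Prop :=
  exists F : set (Z * baire_space)%type,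
    closed F /\ P = [set z | exists y : baire_space, F (z, y)].

Definition Sigma11_complete (R : realType) (X : topologicalType) (A : set X) :
    Prop :=
  forall Z : topologicalType, polish R Z -> clopen_base Z ->
  forall P : set Z, analytic P ->
  exists f : Z -> X, continuous f /\ P = f @^-1` A.

(* Total recursive functionals 2^omega x omega^omega x omega^k -> omega: the
   Kleene recursive functions, uniformly in the two oracles p.1 and p.2.
   Minimization is applied only to regular functions (those for which a zero
   always exists); by Kleene's normal form theorem this loses no total
   functional. *)
Inductive recursive :
    forall k, (cantor_space * baire_space -> k.-tuple nat -> nat) -> Prop :=
| recursive_oracle1 :
    @recursive 1 (fun p v => nat_of_bool (p.1 (thead v)))
| recursive_oracle2 :
    @recursive 1 (fun p v => p.2 (thead v))
| recursive_zero k :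
    @recursive k (fun _ _ => 0%N)
| recursive_succ :
    @recursive 1 (fun _ v => (thead v).+1)
| recursive_proj k (i : 'I_k) :
    @recursive k (fun _ v => tnth v i)
| recursive_comp k m (F : cantor_space * baire_space -> k.-tuple nat -> nat)
    (G : 'I_k -> cantor_space * baire_space -> m.-tuple nat -> nat) :
    recursive F -> (forall i, recursive (G i)) ->
    @recursive m (fun p v => F p [tuple G i p v | i < k])
| recursive_primrec k
    (G : cantor_space * baire_space -> k.-tuple nat -> nat)
    (H : cantor_space * baire_space -> k.+2.-tuple nat -> nat)
    (F : cantor_space * baire_space -> k.+1.-tuple nat -> nat) :
    recursive G -> recursive H ->
    (forall p (v : k.-tuple nat), F p [tuple of 0%N :: v] = G p v) ->
    (forall p (v : k.-tuple nat) n,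
       F p [tuple of n.+1 :: v] =
       H p [tuple of n :: F p [tuple of n :: v] :: v]) ->
    recursive F
| recursive_mu k
    (G : cantor_space * baire_space -> k.+1.-tuple nat -> nat)
    (F : cantor_space * baire_space -> k.-tuple nat -> nat) :
    recursive G ->
    (forall p v, G p [tuple of F p v :: v] = 0%N) ->
    (forall p v n, (n < F p v)%N -> G p [tuple of n :: v] <> 0%N) ->
    recursive F.

(* effectively closed sets: { p | forall n, R(p, n) } with R recursive, R being
   represented by a functional vanishing exactly where R holds *)
Definition lightface_Pi01 (F : set (cantor_space * baire_space)%type) : Prop :=
  exists r : cantor_space * baire_space -> 1.-tuple nat -> nat,
    recursive r /\ F = [set p | forall n : nat, r p [tuple n] = 0%N].

Definition lightface_Sigma11 (A : set cantor_space) : Prop :=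
  exists F : set (cantor_space * baire_space)%type,
    lightface_Pi01 F /\ A = [set x | exists y : baire_space, F (x, y)].

(* Main.v *)
(* The set consists of the x that code a subset of omega^<omega containing all
   initial segments of some y in omega^omega. If P is the projection of a closed
   F in Z x omega^omega and (C_i) is a countable clopen base of Z, send z to the
   set of those s with code m such that some (w, y) in F has y extending s and w
   in the same sets C_i, i < m, as z. This depends on z in a locally constant
   way, and if all y|n are sent to 1, the witnesses (w_n, y_n) in F converge to
   (z, y), so that z is in P. *)
Require Import Defs.
From mathcomp Require Import all_boot all_order all_algebra.
From mathcomp Require Import all_classical all_reals all_analysis.
From mathcomp Require Import zify.

Set Implicit Arguments.
Unset Strict Implicit.
Unset Printing Implicit Defensive.

Import Order.TTheory GRing.Theory Num.Theory.

Local Open Scope classical_set_scope.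

(** * Coding finite sequences by natural numbers *)

Lemma pow2_odd_inj (a b a' b' : nat) :
  2 ^ a * b.*2.+1 = 2 ^ a' * b'.*2.+1 -> a = a' /\ b = b'.
Proof.
(* Parity excludes one zero exponent against a positive one; two positive exponents lose a factor
   2. *)
elim: a a' => [|a IH] [|a']; rewrite ?expnS -?mulnA ?expn0.
- by lia.
- by move: (2 ^ a' * _)%N; lia.
- by move: (2 ^ a * _)%N; lia.
- move=> e; have [|-> ->] // := IH a'.
  by move: (2 ^ a * _)%N (2 ^ a' * _)%N e; lia.
Qed.

(* Code of (y 0, ..., y (n - 1)), by iterating the injection
   (a, c) |-> 2^a (2c + 1). *)
Fixpoint branch_code (y : nat -> nat) (n : nat) : nat :=
  if n is m.+1 then 2 ^ y m * (branch_code y m).*2.+1 else 0.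

(** Makes agreement on all [C i] with [i] below a code cover all [i] below the length of the coded
    string. *)
Lemma leq_branch_code y n : n <= branch_code y n.
Proof.
elim: n => //= n IH.
have : 0 < 2 ^ y n by rewrite expn_gt0.
by move: (2 ^ y n)%N => e; nia.
Qed.

Lemma branch_code_eq y y' n :
  (forall i, i < n -> y i = y' i) -> branch_code y n = branch_code y' n.
Proof.
elim: n => //= n IH e; rewrite IH ?e // => i lin; apply: e; exact: ltnW.
Qed.

(** The length is recovered too, since only the empty string has code 0. *)
Lemma branch_code_inj y y' n n' :
  branch_code y n = branch_code y' n' ->
  n = n' /\ forall i, i < n -> y i = y' i.
Proof.
elim: n n' => [|n IH] [|n'] //=.
- by move=> /esym/eqP; rewrite muln_eq0 expn_eq0.
- by move=> /eqP; rewrite muln_eq0 expn_eq0.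
- move=> /pow2_odd_inj[eyn /IH[enn' ey]]; subst n'; split=> // i.
  by rewrite ltnS leq_eqVlt => /orP[/eqP->|/ey].
Qed.

Definition branch_set : set cantor_space :=
  [set x | exists y : nat -> nat, forall n, x (branch_code y n) = true].

Lemma branch_set_monotone : monotone_set branch_set.
Proof. by move=> x x' [y xy] sub; exists y => n; exact/sub/xy. Qed.

(** * Recursive functionals and the effective complexity of [branch_set] *)

Section Recursive.
Local Notation oracles := (cantor_space * baire_space)%type.

Lemma recursive_ext k (F F' : oracles -> k.-tuple nat -> nat) :
  recursive F -> (forall p v, F p v = F' p v) -> recursive F'.
Proof.
by move=> rF e; rewrite -(_ : F = F') //; apply/funext=> p; apply/funext=> v.
Qed.

Lemma recursive_comp1 m (F : oracles -> nat -> nat)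
    (G : oracles -> m.-tuple nat -> nat) :
  recursive (fun p (v : 1.-tuple nat) => F p (thead v)) -> recursive G ->
  recursive (fun p v => F p (G p v)).
Proof.
move=> rF rG; apply: recursive_ext (recursive_comp (G := fun=> G) rF _) _ => //.
by move=> p v /=; rewrite /thead tnth_mktuple.
Qed.

Lemma recursive_comp2 m (F : oracles -> nat -> nat -> nat)
    (G H : oracles -> m.-tuple nat -> nat) :
  recursive (fun p (v : 2.-tuple nat) => F p (tnth v ord0) (tnth v ord_max)) ->
  recursive G -> recursive H ->
  recursive (fun p v => F p (G p v) (H p v)).
Proof.
move=> rF rG rH.
pose GH (i : 'I_2) := if i == ord0 then G else H.
apply: recursive_ext (recursive_comp (G := GH) rF _) _ => [i|p v] /=.
  by rewrite /GH; case: ifP.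
by rewrite !tnth_mktuple.
Qed.

Lemma recursive_primrec1 (F : oracles -> nat -> nat) (a : nat)
    (H : oracles -> nat -> nat -> nat) :
  recursive (fun p (v : 2.-tuple nat) => H p (tnth v ord0) (tnth v ord_max)) ->
  recursive (fun p (v : 0.-tuple nat) => a) ->
  (forall p, F p 0 = a) -> (forall p n, F p n.+1 = H p n (F p n)) ->
  recursive (fun p (v : 1.-tuple nat) => F p (thead v)).
Proof.
move=> rH ra F0 FS; apply: (recursive_primrec ra rH) => p v; first by rewrite theadE F0.
by move=> n; rewrite !theadE FS.
Qed.

Lemma recursive_S m (G : oracles -> m.-tuple nat -> nat) :
  recursive G -> recursive (fun p v => (G p v).+1).
Proof. exact: (@recursive_comp1 m (fun=> S) G recursive_succ). Qed.

Lemma recursive_double m (G : oracles -> m.-tuple nat -> nat) :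
  recursive G -> recursive (fun p v => (G p v).*2).
Proof.
apply: (@recursive_comp1 m (fun=> double)).
apply: (@recursive_primrec1 (fun=> double) 0 (fun _ _ a => a.+2)) => //.
- by apply/recursive_S/recursive_S/recursive_proj.
- exact: recursive_zero.
Qed.

Lemma recursive_pow2_odd m (G H : oracles -> m.-tuple nat -> nat) :
  recursive G -> recursive H ->
  recursive (fun p v => 2 ^ G p v * (H p v).*2.+1).
Proof.
apply: (@recursive_comp2 m (fun _ a b => 2 ^ a * b.*2.+1)).
(* The recursion runs on the exponent with parameter [b]; in the step tuple (exponent, previous
   value, [b]), index 1 is the previous value, which gets doubled. *)
pose i1 : 'I_3 := Ordinal (isT : 1 < 3).
apply: (@recursive_primrec 1 (fun _ v => (thead v).*2.+1)
                             (fun _ v => (tnth v i1).*2)).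
- exact/recursive_S/recursive_double/recursive_proj.
- exact/recursive_double/recursive_proj.
- by move=> p v; rewrite /thead !(tnth_nth 0) /= expn0 mul1n.
- by move=> p v n; rewrite !(tnth_nth 0) /= expnS -mulnA mul2n.
Qed.

Lemma recursive_branch_code :
  recursive (fun p (v : 1.-tuple nat) => branch_code p.2 (thead v)).
Proof.
apply: (@recursive_primrec1 (fun p => branch_code p.2) 0
          (fun p n c => 2 ^ p.2 n * c.*2.+1)) => //.
- apply: recursive_pow2_odd; last exact: recursive_proj.
  apply: (@recursive_comp1 _ (fun p => p.2)); last exact: recursive_proj.
  exact: recursive_oracle2.
- exact: recursive_zero.
Qed.

Lemma recursive_is0 m (G : oracles -> m.-tuple nat -> nat) :
  recursive G -> recursive (fun p v => nat_of_bool (G p v == 0)).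
Proof.
apply: (@recursive_comp1 m (fun _ n => nat_of_bool (n == 0))).
apply: (@recursive_primrec1 (fun _ n => nat_of_bool (n == 0)) 1
          (fun _ _ _ => 0)) => //.
- exact: recursive_zero.
- exact/recursive_S/recursive_zero.
Qed.

Lemma branch_set_Sigma11 : lightface_Sigma11 branch_set.
Proof.
exists [set p | forall n, p.1 (branch_code p.2 n) = true]; split=> //.
(* The bit is negated because a relation is represented by a functional vanishing where it holds. *)
exists (fun p v => nat_of_bool
          (nat_of_bool (p.1 (branch_code p.2 (thead v))) == 0)); split.
  apply: recursive_is0.
  apply: (@recursive_comp1 _ (fun p n => nat_of_bool (p.1 n))).
    exact: recursive_oracle1.
  exact: recursive_branch_code.
by apply/seteqP; split=> p /= h n; move: (h n); rewrite theadE; case: (p.1 _).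
Qed.

End Recursive.

(** * Convergence in products and countable clopen bases *)

Lemma cvg_prod_topology (I : choiceType) (K : I -> topologicalType)
    (F : set_system (prod_topology K)) (x : prod_topology K) :
  Filter F -> (forall i, (fun y : prod_topology K => y i) @ F --> x i) ->
  F --> x.
Proof.
move=> FF cF; apply/cvg_sup => i U [_ [[V oV <-] /= Vx]] /filterS; apply.
by apply: (cF i V); exact: open_nbhs_nbhs.
Qed.

Lemma eventually_eq_cvg (T : Type) (F : set_system T) (U : topologicalType)
    (f : T -> U) (l : U) :
  Filter F -> (\forall t \near F, f t = l) -> f @ F --> l.
Proof.
move=> FF e V /nbhs_singleton Vl.
by apply: filterS e => t; rewrite /preimage/= => ->.
Qed.

Lemma polish_countable_base (R : realType) (Z : topologicalType) :
  polish R Z -> exists O : nat -> set Z,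
    forall (z : Z) U, nbhs z U -> exists n, nbhs z (O n) /\ O n `<=` U.
Proof.
move=> [[D [/countable_injP[f finj] dD]] [d [d0 dC dtri nbhsd _]]].
(* As [f] is injective on [D], each [B nk] is a single ball of radius 1/(k+1) centred in [D], or
   empty. *)
pose B (nk : nat * nat) :=
  [set y | exists x, [/\ D x, f x = nk.1 & (d x y < nk.2.+1%:R^-1)%R]].
exists (fun n => if unpickle n is Some nk then B nk else set0) => z U.
move=> /nbhsd[e e0 eU].
(* A centre within 1/(k+1) of [z] has its ball within 2/(k+1) of [z], hence inside [U]. *)
have [k ke] : exists k, (k.+1%:R^-1 + k.+1%:R^-1 < e)%R.
  have e2 : (0 < e / 2)%R by rewrite divr_gt0.
  exists (Num.truncn (e / 2)^-1).
  rewrite [ltRHS](splitr e) ltrD// invf_plt ?posrE// truncnS_gt//.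
have opend (x : Z) (r : R) : open [set y | (d x y < r)%R].
  rewrite openE => y /= xy; apply/nbhsd; exists (r - d x y)%R.
    by rewrite subr_gt0.
  move=> w /= yw; apply: le_lt_trans (dtri x y w) _.
  by rewrite addrC -ltrBrDr.
have [|x [/= zx Dx]] := dD [set y | (d z y < k.+1%:R^-1)%R] _ (opend _ _).
  by exists z => /=; rewrite (proj2 (proj2 (d0 z z))) // invr_gt0.
exists (pickle (f x, k)); rewrite pickleK; split.
  have : nbhs z [set y | (d x y < k.+1%:R^-1)%R].
    by apply: open_nbhs_nbhs; split; [exact: opend|rewrite /= dC].
  by apply: filterS => y /= xy; exists x.
move=> y [x' [/= Dx' ex' xy]]; apply: eU => /=.
have {ex'} ex : x' = x by apply: finj; rewrite ?inE.
subst x'; apply: le_lt_trans (dtri z x y) (lt_trans _ ke).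
exact: ltrD.
Qed.

(* For each pair of basic sets [O i], [O j] with a clopen set in between, choose
   one such clopen set. *)
Lemma countable_clopen_base (Z : topologicalType) (O : nat -> set Z) :
  clopen_base Z ->
  (forall (z : Z) U, nbhs z U -> exists n, nbhs z (O n) /\ O n `<=` U) ->
  exists C : nat -> set Z, (forall n, clopen (C n)) /\
    forall (z : Z) U, nbhs z U -> exists n, C n z /\ C n `<=` U.
Proof.
move=> cZ bO.
have [C hC] : {C : nat * nat -> set Z & forall ij, clopen (C ij) /\
    ((exists V, [/\ clopen V, O ij.1 `<=` V & V `<=` O ij.2]) ->
     O ij.1 `<=` C ij /\ C ij `<=` O ij.2)}.
  apply: (@choice _ _ (fun ij (C : set Z) => clopen C /\
    ((exists V, [/\ clopen V, O ij.1 `<=` V & V `<=` O ij.2]) ->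
     O ij.1 `<=` C /\ C `<=` O ij.2))).
  move=> [i j] /=.
  have [[V [cV iV Vj]]|nV] :=
    pselect (exists V, [/\ clopen V, O i `<=` V & V `<=` O j]).
    by exists V.
  by exists set0; split=> //; split; [exact: open0|exact: closed0].
exists (fun n => if unpickle n is Some ij then C ij else set0); split.
  move=> n; case: unpickle => [ij|]; first exact: (hC ij).1.
  by split; [exact: open0|exact: closed0].
(* Shrink three times around [z]: [O j] inside [U], a clopen [V] inside [O j], then [O i] inside
   [V]. So the choice for [(i, j)] is a genuine one. *)
move=> z U /bO[j [zj jU]]; have [V [cV Vz Vj]] := cZ _ _ zj.
have [|i [zi iV]] := bO z V.
  by apply: open_nbhs_nbhs; split=> //; case: cV.
have [|iC Cj] := (hC (i, j)).2; first by exists V.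
exists (pickle (i, j)); rewrite pickleK; split.
  exact: iC (nbhs_singleton zi).
exact: subset_trans Cj jU.
Qed.

(** For each of the finitely many [i], either [C i] or its complement is a neighbourhood of [z]. *)
Lemma clopen_agree_near (Z : topologicalType) (C : nat -> set Z) (z : Z) n :
  (forall i, clopen (C i)) ->
  \forall w \near z, forall i, i < n -> C i w <-> C i z.
Proof.
move=> cC; elim: n => [|n IH]; first by apply: nearW.
have ag : \forall w \near z, C n w <-> C n z.
  have [Cz|nCz] := pselect (C n z).
    have : nbhs z (C n) by apply: open_nbhs_nbhs; split=> //; case: (cC n).
    by apply: filterS.
  have : nbhs z (~` C n).
    by apply: open_nbhs_nbhs; split=> //; apply: closed_openC; case: (cC n).
  by apply: filterS.
apply: filterS2 IH ag => w h hn i.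
by rewrite ltnS leq_eqVlt => /orP[/eqP->|/h].
Qed.

(** * The continuous reduction of a projection to [branch_set] *)

Section Reduction.
Variables (Z : topologicalType) (C : nat -> set Z).
Variable F : set (Z * baire_space)%type.
Hypothesis clopenC : forall n, clopen (C n).
Hypothesis baseC : forall (z : Z) U, nbhs z U -> exists n, C n z /\ C n `<=` U.

(** Bounding [i] by the code [m] leaves finitely many conditions on [z] for each [m], yet every
    [C i] is eventually compared along a branch, since codes are at least the lengths. *)
Definition section_tree (z : Z) (m : nat) : Prop :=
  exists n (w : Z) (y : baire_space), [/\ F (w, y), branch_code y n = m &
    forall i, i < m -> C i w <-> C i z].

Definition reduction (z : Z) : cantor_space := fun m => `[< section_tree z m >].

Lemma reduction_continuous : continuous reduction.
Proof.
move=> z; apply: cvg_prod_topology => m; apply: eventually_eq_cvg.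
apply: filterS (@clopen_agree_near _ C z m clopenC) => w wz.
apply: asbool_equiv_eq; split=> -[n [w' [y [Fwy ym ww']]]]; exists n, w', y.
  by split=> // i im; rewrite ww' // wz.
by split=> // i im; rewrite ww' // wz.
Qed.

Lemma reductionP z : closed F ->
  (exists y, F (z, y)) <-> branch_set (reduction z).
Proof.
move=> cF; split=> [[y Fzy]|[y yz]].
  (* The point [z] itself witnesses every initial segment of [y]. *)
  by exists y => n; apply/asboolP; exists n, z, y.
have {yz} /choice[wy wyP] : forall n, exists wy : Z * baire_space,
    [/\ F wy, forall i, i < n -> wy.2 i = y i &
        forall i, i < n -> C i wy.1 <-> C i z].
  move=> n; have /asboolP[n' [w [y' [Fwy /branch_code_inj[<- e] wz]]]] := yz n.
  exists (w, y'); split=> // i lin.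
  by apply: wz; apply: leq_trans lin (leq_branch_code _ _).
(* Since [F] is closed, it suffices that the witnesses [wy n] converge to [(z, y)]. *)
exists y; apply: (@closed_cvg _ _ \oo _ wy F cF).
  by apply: nearW => n; case: (wyP n).
rewrite (_ : wy = fun n => ((wy n).1, (wy n).2)); last first.
  by apply/funext=> n; case: (wy n).
apply: (@cvg_pair _ _ _ \oo (nbhs z) (nbhs (y : baire_space))) => /=.
  (* From stage [i.+1] on, the first components agree with [z] on [C i], so they lie in [U]. *)
  move=> U /baseC[i [Ciz CU]]; exists i.+1 => // n /= lin; apply: CU.
  by have [_ _ /(_ i lin)[_]] := wyP n; apply.
apply: cvg_prod_topology => i; apply: eventually_eq_cvg.
by exists i.+1 => // n /= lin; case: (wyP n) => _ /(_ i lin).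
Qed.

End Reduction.

Lemma branch_set_complete (R : realType) : Sigma11_complete R branch_set.
Proof.
move=> Z pZ cZ P [F [cF ->]].
have [B bB] := polish_countable_base pZ.
have [C [cC bC]] := countable_clopen_base cZ bB.
exists (reduction C F); split; first exact: reduction_continuous.
by apply/seteqP; split=> z /= /(reductionP bC z cF).
Qed.

Theorem proposition2p1 (R : realType) :
  exists A : set cantor_space,
    lightface_Sigma11 A /\ monotone_set A /\ Sigma11_complete R A.
Proof.
exists branch_set; split; first exact: branch_set_Sigma11.
split; [exact: branch_set_monotone|exact: branch_set_complete].
Qed.
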